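(* Let $N\ge3$, $s_1,s_2\in(0,2)$, $\mu>0$, $\kappa\ne0$, $\alpha>1$, $\beta>1$, $\alpha+\beta=2^*(s_2)$, and let $\lambda=\mu\big(\frac{\beta}{\alpha}\big)^{\frac{2^*(s_1)-2}{2}}$. Suppose one of the following holds: (i) $0<s_1<s_2<2$ and $\kappa\in\mathbb{R}\setminus\{0\}$; (ii) $s_1>s_2$ and $\kappa>0$; (iii) $s_1=s_2$ and $\kappa>-\lambda\frac1\alpha\big(\frac\alpha\beta\big)^{\frac\beta2}$. Then $\big(w,\sqrt{\tfrac\beta\alpha}\,w\big)$ is a positive solution of $$-\Delta u-\lambda\frac{|u|^{2^*(s_1)-2}u}{|x|^{s_1}}=\kappa\alpha\frac{|u|^{\alpha-2}u|v|^\beta}{|x|^{s_2}},\qquad -\Delta v-\mu\frac{|v|^{2^*(s_1)-2}v}{|x|^{s_1}}=\kappa\beta\frac{|u|^{\alpha}|v|^{\beta-2}v}{|x|^{s_2}}\quad\text{in }\mathbb{R}^N_+,\quad (u,v)\in D_0^{1,2}(\mathbb{R}^N_+)\times D_0^{1,2}(\mathbb{R}^N_+),$$ where $w$ is a least-energy solution of $$-\Delta w-\lambda\frac{w^{2^*(s_1)-1}}{|x|^{s_1}}-\kappa\alpha\Big(\frac\beta\alpha\Big)^{\frac\beta2}\frac{w^{2^*(s_2)-1}}{|x|^{s_2}}=0\ \text{ in }\mathbb{R}^N_+,\qquad w\in D_0^{1,2}(\mathbb{R}^N_+),\ w>0\text{ in }\mathbb{R}^N_+.$$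
   Context: $2^*(s):=\frac{2(N-s)}{N-2}$. $\mathbb{R}^N_+$ is the open half space; $D_0^{1,2}(\mathbb{R}^N_+)$ is the completion of $C_c^\infty(\mathbb{R}^N_+)$ in the norm $(\int|\nabla u|^2dx)^{1/2}$. Solutions are weak solutions. It is known (Li–Lin, Egnell) that under any of (i)–(iii) the scalar problem for $w$ has a least-energy solution. *)

(* Defs.v *)
From HB Require Import structures.
From mathcomp Require Import all_boot all_order all_algebra.
From mathcomp Require Import all_classical all_reals all_analysis.

Set Implicit Arguments.
Unset Strict Implicit.
Unset Printing Implicit Defensive.
Import Order.TTheory GRing.Theory Num.Theory.
Import numFieldNormedType.Exports.
Local Open Scope classical_set_scope.
Local Open Scope ring_scope.

(* The library has no Lebesgue measure on R^N: equip row vectors with the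
   sigma-algebra generated by the coordinates (the Borel sets), and build the
   N-fold product of the one-dimensional Lebesgue measure on it. *)

Definition measure_rV_display : measure_display -> measure_display.
Proof. exact. Qed.

Section measurable_rV.
Context {d} {T : measurableType d}.
Variable n : nat.

Let coors : 'I_n -> 'rV[T]_n -> T := fun i x => x ord0 i.

Let rV_set0 : g_sigma_preimage coors set0.
Proof. exact: sigma_algebra0. Qed.

Let rV_setC A : g_sigma_preimage coors A -> g_sigma_preimage coors (~` A).
Proof. exact: sigma_algebraC. Qed.

Let rV_bigcup (F : _^nat) : (forall i, g_sigma_preimage coors (F i)) ->
  g_sigma_preimage coors (\bigcup_i (F i)).
Proof. exact: sigma_algebra_bigcup. Qed.

HB.instance Definition _ := @isMeasurable.Build (measure_rV_display d)
  'rV[T]_n (g_sigma_preimage coors) rV_set0 rV_setC rV_bigcup.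

End measurable_rV.

Lemma measurable_coord d (T : measurableType d) n (i : 'I_n) :
  measurable_fun [set: 'rV[T]_n] (fun x => x ord0 i).
Proof.
move=> _ Y mY; rewrite setTI; apply: sub_sigma_algebra => /=.
rewrite -bigcup_seq/=; exists i => /=; first by rewrite mem_index_enum.
by exists Y => //; rewrite setTI.
Qed.

Lemma measurable_fun_rV d d' (T1 : measurableType d) (T2 : measurableType d') n
    (f : T1 -> 'rV[T2]_n) :
  (forall i, measurable_fun [set: T1] (fun x => f x ord0 i)) ->
  measurable_fun [set: T1] f.
Proof.
move=> mf _ A mA; rewrite setTI.
have : (image_set_system setT f measurable) A.
  suff: g_sigma_preimage (fun i (x : 'rV[T2]_n) => x ord0 i) `<=`
    image_set_system setT f measurable by exact.
  apply: smallest_sub.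
    exact/sigma_algebra_image/sigma_algebra_measurable.
  rewrite -bigcup_seq => B [i _ [C mC <-]].
  rewrite /image_set_system /= !setTI.
  by have := mf i measurableT C mC; rewrite setTI.
by rewrite /image_set_system /= setTI.
Qed.

Definition rV_cons (R : realType) (n : nat) (p : R * 'rV[R]_n) : 'rV[R]_n.+1 :=
  row_mx (const_mx p.1 : 'rV_1) p.2.

Lemma measurable_rV_cons (R : realType) (n : nat) :
  measurable_fun [set: 'rV[R]_n * R] (fun p => rV_cons (p.2, p.1)).
Proof.
apply: measurable_fun_rV => i.
case: (@splitP 1 n i) => [j ij|j ij].
  have -> : i = lshift n j by apply: val_inj.
  rewrite [X in measurable_fun _ X](_ : _ = snd).
    exact: measurable_snd.
  apply/funext => p; transitivity ((const_mx p.2 : 'rV[R]_1) ord0 j).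
    exact: row_mxEl.
  by rewrite mxE.
have -> : i = rshift 1 j by apply: val_inj.
rewrite [X in measurable_fun _ X](_ : _ =
  (fun x : 'rV[R]_n => x ord0 j) \o fst).
  exact: (measurableT_comp (measurable_coord j) measurable_fst).
by apply/funext => p; exact: row_mxEr.
Qed.

Section lebesgue_rV_step.
Context (R : realType) (n : nat).
Variable m : {measure set 'rV[R]_n -> \bar R}.

Definition lebesgue_rV_step : set 'rV[R]_n.+1 -> \bar R :=
  pushforward (m \x (@lebesgue_measure R))%E (fun p => rV_cons (p.2, p.1)).

HB.instance Definition _ := Measure.copy lebesgue_rV_step
  (measure_function_pushforward__canonical__measure_function_Measure
   (m \x (@lebesgue_measure R))%E (@measurable_rV_cons R n)).

End lebesgue_rV_step.

Fixpoint lebesgue_rV (R : realType) (n : nat) :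
    {measure set 'rV[R]_n -> \bar R} :=
  match n with
  | 0 => \d_(0 : 'rV[R]_0)
  | n'.+1 => lebesgue_rV_step (lebesgue_rV R n')
  end.

Lemma lebesgue_rV_box (R : realType) (n : nat) (A : 'I_n -> set R) :
  (forall i, measurable (A i)) ->
  lebesgue_rV R n [set x | forall i, A i (x ord0 i)] =
  (\prod_(i < n) lebesgue_measure (A i))%E.
Proof.
elim: n A => [|n IH] A mA /=.
  rewrite big_ord0 /dirac indicE mem_set//=.
  by case.
rewrite /lebesgue_rV_step /pushforward.
have mB : measurable [set x : 'rV[R]_n | forall i, A (rshift 1 i) (x ord0 i)].
  rewrite [X in measurable X](_ : _ = \big[setI/setT]_(i < n)
      ((fun x : 'rV[R]_n => x ord0 i) @^-1` A (rshift 1 i))).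
    apply: bigsetI_measurable => i _.
    rewrite -[X in measurable X]setTI.
    exact: (measurable_coord i measurableT (mA _)).
  apply/seteqP; split=> [x Ax|x].
    by rewrite -bigcap_seq => i _; exact: Ax.
  rewrite -bigcap_seq => H i; apply: (H i).
  by rewrite /= mem_index_enum.
transitivity ((lebesgue_rV R n \x (@lebesgue_measure R))%E
  ([set x : 'rV[R]_n | forall i, A (rshift 1 i) (x ord0 i)] `*`
    A (@lshift 1 n ord0))).
  congr (_ _); apply/seteqP; split=> -[x t] /=.
    move=> H; split => [i|].
      have := H (rshift 1 i); rewrite [X in A _ X -> _](_ : _ = x ord0 i) //.
      exact: row_mxEr.
    have := H (@lshift 1 n ord0); rewrite [X in A _ X -> _](_ : _ = t) //.
    by transitivity ((const_mx t : 'rV[R]_1) ord0 ord0);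
      [exact: row_mxEl | rewrite mxE].
  move=> [H1 H2] i; case: (@splitP 1 n i) => [j ij|j ij].
    have -> : i = lshift n j by apply: val_inj.
    rewrite [X in A _ X](_ : _ = t) ?(ord1 j) //.
    by transitivity ((const_mx t : 'rV[R]_1) ord0 ord0);
      [exact: row_mxEl | rewrite mxE].
  have -> : i = rshift 1 j by apply: val_inj.
  rewrite [X in A _ X](_ : _ = x ord0 j) //.
  exact: row_mxEr.
rewrite product_measure1E//; last exact: mA.
rewrite big_ord_recl muleC; congr (_ * _)%E.
  by congr (lebesgue_measure (A _)); apply: val_inj.
rewrite (IH (fun i => A (rshift 1 i)))//.
by apply: eq_bigr => i _; congr (lebesgue_measure (A _)); apply: val_inj.
Qed.

Section sobolev.
Context {R : realType} {N : nat}.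
Implicit Types (u v w phi : 'rV[R]_N -> R) (G : 'rV[R]_N -> 'rV[R]_N).

(* The library norm on 'rV[R]_N is the sup norm. *)
Definition dot (x y : 'rV[R]_N) : R := \sum_(i < N) x ord0 i * y ord0 i.
Definition enorm (x : 'rV[R]_N) : R := Num.sqrt (dot x x).

Definition partial (i : 'I_N) phi : 'rV[R]_N -> R :=
  fun x => 'D_(delta_mx ord0 i) phi x.

Definition grad phi : 'rV[R]_N -> 'rV[R]_N :=
  fun x => \row_i partial i phi x.

Definition smooth phi : Prop := forall l : seq 'I_N,
  continuous (foldr partial phi l) /\
  forall i x, derivable (foldr partial phi l) x (delta_mx ord0 i).

Definition half_space : set 'rV[R]_N :=
  [set x | forall i : 'I_N, i.+1 = N -> 0 < x ord0 i].

(* C_c^oo of the half space, with functions extended by zero to R^N. *)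
Definition test_function phi : Prop := smooth phi /\
  exists K, [/\ compact K, K `<=` half_space & forall x, ~ K x -> phi x = 0].

(* The Hardy-Sobolev exponent 2^*(s); 2^*(0) is the Sobolev exponent. *)
Definition crit (s : R) : R := 2 * (N%:R - s) / (N%:R - 2).

Notation mu := (lebesgue_rV R N).

(* u is an element of D_0^{1,2} of the half space, with weak gradient G.  By
   the Sobolev inequality the completion of the test functions in the norm
   (\int |grad u|^2)^(1/2) is a space of functions: a sequence that is Cauchy
   in this norm converges in L^{2^*(0)}, and u is that limit while G is the
   L^2 limit of the gradients, unique up to a null set.  Values outside the half
   space are irrelevant here and below. *)
Definition D012_grad u G : Prop :=
  [/\ measurable_fun half_space u,
      forall i, measurable_fun half_space (fun x => G x ord0 i) &
      exists phi_ : nat -> 'rV[R]_N -> R,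
      [/\ forall k, test_function (phi_ k),
          (\int[mu]_(x in half_space)
            (enorm (grad (phi_ k) x - G x) ^+ 2)%:E)%E @[k --> \oo] --> 0%E &
          (\int[mu]_(x in half_space)
            (`|phi_ k x - u x| `^ crit 0)%:E)%E @[k --> \oo] --> 0%E]].

(* - Delta u = f in the half space, tested against C_c^oo, where G is the weak
   gradient of u. *)
Definition weak_poisson G (f : 'rV[R]_N -> R) : Prop :=
  forall phi, test_function phi ->
    mu.-integrable half_space (EFin \o (fun x => f x * phi x)) /\
    \int[mu]_(x in half_space) dot (G x) (grad phi x) =
    \int[mu]_(x in half_space) (f x * phi x).

(* Elements of D_0^{1,2} are classes modulo null sets. *)
Definition positive u : Prop := {ae mu, forall x, half_space x -> 0 < u x}.

(* w is a solution, with weak gradient G, of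
   - Delta w - a w^(2^*(s1)-1)/|x|^s1 - b w^(2^*(s2)-1)/|x|^s2 = 0, w > 0. *)
Definition scalar_solution (s1 s2 a b : R) w G : Prop :=
  [/\ D012_grad w G, positive w &
      weak_poisson G (fun x =>
        a * (w x `^ (crit s1 - 1) / enorm x `^ s1)
        + b * (w x `^ (crit s2 - 1) / enorm x `^ s2))].

Definition scalar_energy (s1 s2 a b : R) w G : R :=
  2^-1 * \int[mu]_(x in half_space) (enorm (G x) ^+ 2)
  - a / crit s1 *
      \int[mu]_(x in half_space) (`|w x| `^ crit s1 / enorm x `^ s1)
  - b / crit s2 *
      \int[mu]_(x in half_space) (`|w x| `^ crit s2 / enorm x `^ s2).

Definition least_energy_solution (s1 s2 a b : R) w : Prop :=
  exists G, scalar_solution s1 s2 a b w G /\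
    forall w' G', scalar_solution s1 s2 a b w' G' ->
      scalar_energy s1 s2 a b w G <= scalar_energy s1 s2 a b w' G'.

Definition system_solution (s1 s2 lambda m kappa alpha beta : R) u v : Prop :=
  exists Gu Gv, [/\ D012_grad u Gu, D012_grad v Gv,
    weak_poisson Gu (fun x =>
      lambda * (`|u x| `^ (crit s1 - 2) * u x / enorm x `^ s1)
      + kappa * alpha *
        (`|u x| `^ (alpha - 2) * u x * `|v x| `^ beta / enorm x `^ s2)) &
    weak_poisson Gv (fun x =>
      m * (`|v x| `^ (crit s1 - 2) * v x / enorm x `^ s1)
      + kappa * beta *
        (`|u x| `^ alpha * `|v x| `^ (beta - 2) * v x / enorm x `^ s2))].

Definition positive_system_solution (s1 s2 lambda m kappa alpha beta : R) u v :
    Prop :=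
  [/\ system_solution s1 s2 lambda m kappa alpha beta u v,
      positive u & positive v].

End sobolev.
Arguments crit {R} N s.

(* Main.v *)
Require Import Defs.
From HB Require Import structures.
From mathcomp Require Import all_boot all_order all_algebra.
From mathcomp Require Import all_classical all_reals all_analysis.
From mathcomp Require Import measurable_realfun ring.
Import Order.TTheory GRing.Theory Num.Theory.
Import numFieldNormedType.Exports.
Local Open Scope classical_set_scope.
Local Open Scope ring_scope.

(** The ansatz [(u, v) = (w, t w)] with [t = sqrt (beta / alpha)] reduces both
equations of the system to the single equation that [w] solves.
Where [w > 0], which is almost everywhere, powers of [w] can be collected:
since [alpha + beta = 2^*(s2)] and [t ^ beta = (beta / alpha) ^ (beta / 2)], the
right-hand side of the first equation is that of the scalar equation.  The
right-hand side of the second equation is [t] times the scalar one, because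
[mu * t ^ (2^*(s1) - 1) = t * lambda] by the choice of [lambda] and
[beta * t ^ (beta - 1) = t * alpha * t ^ beta] by the choice of [t].  As
[- Delta (t w) = t (- Delta w)], both equations follow.

Weakly, this needs three facts: membership in the energy space and weak
solutions are preserved by multiplication by [t] ([D012_gradZ],
[weak_poissonZ]), and a right-hand side may be changed on a null set
([ae_eq_weak_poisson]).  All three manipulate Lebesgue integrals of expressions
involving test functions and their gradients, which are measurable for the
sigma-algebra generated by the coordinates because they are continuous and open
sets are countable unions of cubes ([open_measurable_rV]). *)

(** * Measurability of open sets and of continuous functions on R^N *)

Lemma measurable_coord_forall (R : realType) (N : nat) (A : 'I_N -> set R) :
  (forall i, measurable (A i)) ->
  measurable [set x : 'rV[R]_N | forall i, A i (x ord0 i)].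
Proof.
move=> mA; rewrite [X in measurable X](_ : _ = \big[setI/setT]_(i < N)
    ((fun x : 'rV[R]_N => x ord0 i) @^-1` A i)).
  apply: bigsetI_measurable => i _; rewrite -[X in measurable X]setTI.
  exact: (measurable_coord _ measurableT (mA _)).
apply/seteqP; split=> [x Ax|x]; rewrite -bigcap_seq.
  by move=> i _; exact: Ax.
by move=> H i; apply: (H i); rewrite /= mem_index_enum.
Qed.

Lemma measurable_half_space (R : realType) (N : nat) :
  measurable (@half_space R N).
Proof.
apply: (@measurable_coord_forall _ _ (fun i => [set r | i.+1 = N -> 0 < r])).
move=> i; have [iN|iN] := pselect (i.+1 = N).
  rewrite [X in measurable X](_ : _ = `]0, +oo[%classic) //.
  by apply/seteqP; split=> r /=; rewrite in_itv/= andbT // => H; exact: H.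
rewrite [X in measurable X](_ : _ = setT) //.
by apply/seteqP; split=> r //= _ /iN.
Qed.

(** The norm on row vectors is the sup norm, so its balls are cubes, which are
measurable coordinatewise.  An open set is the union of the cubes with rational
centre and radius [1 / k.+1] that it contains, and there are only countably many
of these. *)
Lemma open_measurable_rV (R : realType) (N : nat) (U : set 'rV[R]_N) :
  open U -> measurable U.
Proof.
move=> oU.
pose box (p : 'rV[rat]_N * nat) : set 'rV[R]_N :=
  [set x | forall i, `|x ord0 i - ratr (p.1 ord0 i)| < p.2.+1%:R^-1].
have mbox p : measurable (box p).
  apply: (@measurable_coord_forall _ _
    (fun i => [set r | `|r - ratr (p.1 ord0 i)| < p.2.+1%:R^-1])) => i.
  rewrite [X in measurable X](_ : _ =
    `]ratr (p.1 ord0 i) - p.2.+1%:R^-1,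
      ratr (p.1 ord0 i) + p.2.+1%:R^-1[%classic)//.
  by apply/seteqP; split=> r /=; rewrite in_itv/= ltr_distl.
rewrite [X in measurable X](_ : _ =
    \bigcup_p (if `[< box p `<=` U >] then box p else set0)).
  apply: countable_bigcupT_measurable; first exact: countableP.
  by move=> p; case: ifP.
apply/seteqP; split=> [x Ux|x [p _]]; last by case: ifPn => // /asboolP; apply.
(* A cube of radius less than [e / 2] containing [x] lies in the cube of radius
   [e] centred at [x]. *)
have /nbhs_ballP[e /= e0 xeU] : nbhs x U by rewrite nbhsE; exists U.
have [k _ ke] := near_infty_natSinv_lt (PosNum (divr_gt0 e0 (@ltr0Sn R 1))).
have {}ke := ke k (leqnn k).
have k0 : 0 < (k.+1%:R^-1 : R) by rewrite invr_gt0.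
have xq i : exists q : rat, `|x ord0 i - ratr q| < k.+1%:R^-1.
  have /rat_in_itvoo[q] : x ord0 i - k.+1%:R^-1 < x ord0 i + k.+1%:R^-1.
    by rewrite ltrD2l (lt_trans _ k0)// oppr_lt0.
  by rewrite in_itv/= => qx; exists q; rewrite distrC ltr_distl.
have [q xq'] := choice xq.
exists (\row_i q i, k) => //.
have bx : box (\row_i q i, k) x by move=> i /=; rewrite mxE.
case: ifPn => // /asboolPn; case=> y yb; apply: xeU; split=> // i j.
rewrite /ball/= ord1.
have := yb j; have := bx j => /= H1 H2.
rewrite -(subrK (ratr ((\row_i q i) ord0 j)) (x ord0 j)) -addrA.
rewrite (le_lt_trans (ler_normD _ _))// [e]splitr ltrD//.
  exact: lt_trans ke.
by rewrite distrC; exact: lt_trans ke.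
Qed.

Lemma continuous_measurable_rV (R : realType) (N : nat) (f : 'rV[R]_N -> R) :
  continuous f -> measurable_fun setT f.
Proof.
move=> /continuousP cf; apply: (measurability _ (RGenOpens.measurableE R)).
move=> _ [_ [a [b ->] <-]]; rewrite setTI; apply: open_measurable_rV.
by apply: cf; exact: interval_open.
Qed.

(** * Scaling of test functions and gradients *)

Section scaling.
Context (R : realType) (N : nat) (c : R).
Implicit Types (phi u f : 'rV[R]_N -> R) (G : 'rV[R]_N -> 'rV[R]_N).

Lemma partialZ i phi : (forall x, derivable phi x (delta_mx ord0 i)) ->
  partial i (fun x => c * phi x) = (fun x => c * partial i phi x).
Proof.
by move=> dphi; apply/funext => x; rewrite /partial (@deriveZ _ _ R^o).
Qed.

Lemma foldr_partialZ phi l : smooth phi ->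
  foldr partial (fun x => c * phi x) l =
  (fun x => c * foldr partial phi l x).
Proof.
move=> sphi; elim: l => [//|i l IH] /=.
by rewrite IH partialZ//; exact: (sphi l).2.
Qed.

Lemma gradZ phi x : smooth phi ->
  grad (fun x => c * phi x) x = c *: grad phi x.
Proof.
move=> sphi; apply/rowP => i; rewrite !mxE partialZ//.
exact: (sphi [::]).2.
Qed.

Lemma test_functionZ phi :
  test_function phi -> test_function (fun x => c * phi x).
Proof.
move=> [sphi [K [cK KH phi0]]]; split; last first.
  by exists K; split=> // x /phi0 ->; rewrite mulr0.
move=> l; rewrite foldr_partialZ//; have [cphi dphi] := sphi l; split.
  move=> x; apply: (@continuousM _ _ (fun=> c)); last exact: cphi.
  exact: cst_continuous.
by move=> i x; exact: (@derivableZ _ _ R^o).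
Qed.

Lemma dotZl (x y : 'rV[R]_N) : dot (c *: x) y = c * dot x y.
Proof.
by rewrite /dot mulr_sumr; apply: eq_bigr => i _; rewrite mxE mulrA.
Qed.

Lemma enormZ_sqr (x : 'rV[R]_N) : enorm (c *: x) ^+ 2 = c ^+ 2 * enorm x ^+ 2.
Proof.
have dot0 (y : 'rV[R]_N) : 0 <= dot y y.
  by apply: sumr_ge0 => i _; rewrite -expr2 sqr_ge0.
rewrite /enorm !sqr_sqrtr// dotZl /dot expr2 -mulrA; congr (_ * _).
by rewrite mulr_sumr; apply: eq_bigr => i _; rewrite mxE mulrCA.
Qed.

End scaling.

(** * Measurability of the integrands *)

Section measurability.
Context (R : realType) (N : nat).
Implicit Types (phi u f : 'rV[R]_N -> R) (G : 'rV[R]_N -> 'rV[R]_N).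

Lemma test_function_measurable phi D : test_function phi ->
  measurable_fun D phi.
Proof.
move=> [sphi _]; apply: measurable_funTS.
by apply: continuous_measurable_rV; exact: (sphi [::]).1.
Qed.

Lemma grad_measurable phi D i : test_function phi ->
  measurable_fun D (fun x => grad phi x ord0 i).
Proof.
move=> [sphi _]; apply: measurable_funTS.
under eq_fun do rewrite mxE.
by apply: continuous_measurable_rV; exact: (sphi [:: i]).1.
Qed.

Lemma measurable_dot D (F G : 'rV[R]_N -> 'rV[R]_N) :
  (forall i, measurable_fun D (fun x => F x ord0 i)) ->
  (forall i, measurable_fun D (fun x => G x ord0 i)) ->
  measurable_fun D (fun x => dot (F x) (G x)).
Proof.
by move=> mF mG; apply: measurable_sum => i; exact: measurable_funM.
Qed.

Lemma measurable_enorm D G :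
  (forall i, measurable_fun D (fun x => G x ord0 i)) ->
  measurable_fun D (fun x => enorm (G x)).
Proof.
move=> mG; apply: (@measurableT_comp _ _ _ _ _ _ (@Num.sqrt R) _
  (fun x => dot (G x) (G x))) => //.
  by apply: continuous_measurable_fun; exact: sqrt_continuous.
exact: measurable_dot.
Qed.

Lemma measurable_powR_fun D f p : measurable_fun D f ->
  measurable_fun D (fun x => f x `^ p).
Proof.
by move=> mf; apply: (@measurableT_comp _ _ _ _ _ _ (@powR R ^~ p)) => //.
Qed.

Lemma measurable_singular_weight D f s : measurable_fun D f ->
  measurable_fun D (fun x => f x / enorm x `^ s).
Proof.
move=> mf; apply: measurable_funM => //.
under eq_fun do rewrite -powRN.
apply: measurable_powR_fun; apply: (measurable_enorm D (fun x => x)) => i.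
by apply: measurable_funTS; exact: measurable_coord.
Qed.

End measurability.

(** * Weak solutions under scaling and under changes on null sets *)

(** Integrability of [f] is not assumed: for [c > 0] the positive and negative
parts scale separately, and a difference of two infinite integrals keeps its
value under scaling.  This spares proving that the product of the weak gradient
with the gradient of a test function is integrable. *)
Lemma integralZl_gt0 d (T : measurableType d) (R : realType)
    (m : {measure set T -> \bar R}) (D : set T) (f : T -> R) (c : R) :
  0 < c -> measurable D -> measurable_fun D f ->
  \int[m]_(x in D) (c * f x) = c * \int[m]_(x in D) f x.
Proof.
move=> c0 mD mf; have mEf : measurable_fun D (EFin \o f).
  exact/measurable_EFinP.
rewrite /Rintegral.
under eq_integral do rewrite EFinM.
rewrite integralE [in RHS]integralE ge0_funeposM ?ltW// ge0_funenegM ?ltW//.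
rewrite !ge0_integralZl_EFin ?ltW//; last 2 first.
  exact: measurable_funeneg.
  exact: measurable_funepos.
have : (0 <= \int[m]_(x in D) (fun x => (f x)%:E)^\+ x)%E.
  exact: integral_ge0.
have : (0 <= \int[m]_(x in D) (fun x => (f x)%:E)^\- x)%E.
  exact: integral_ge0.
case: (\int[m]_(x in D) _^\+ x)%E => [a||]//;
  case: (\int[m]_(x in D) _^\- x)%E => [b||]// _ _;
  rewrite ?gt0_muley ?lte_fin//= ?mulr0//.
by rewrite -mulrBr.
Qed.

Section weak_solutions.
Context (R : realType) (N : nat).
Implicit Types (phi u f g : 'rV[R]_N -> R) (G : 'rV[R]_N -> 'rV[R]_N).

(** The approximating test functions are scaled along with [u]; the two error
integrals get multiplied by [c ^ 2] and by [c ^ 2^*(0)]. *)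
Lemma D012_gradZ (c : R) u G : 0 < c -> D012_grad u G ->
  D012_grad (fun x => c * u x) (fun x => c *: G x).
Proof.
move=> c0 [mu mG [phi [tphi cG cu]]]; split.
- exact: measurable_funM.
- by move=> i; under eq_fun do rewrite mxE; exact: measurable_funM.
exists (fun k x => c * phi k x); split.
- by move=> k; exact: test_functionZ.
- rewrite -[X in _ --> X](mule0 (c ^+ 2)%:E).
  have := cvgeZl (isT : (c ^+ 2)%:E \is a fin_num) cG.
  apply: cvg_trans; apply: near_eq_cvg; apply: nearW => k.
  rewrite -ge0_integralZl_EFin ?sqr_ge0//; first last.
  + apply/measurable_EFinP; apply: measurable_funX.
    apply: (measurable_enorm _ _ _ (fun x => grad (phi k) x - G x)) => i.
    under eq_fun do rewrite !mxE.
    apply: measurable_funB => //.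
    have := grad_measurable _ _ _ half_space i (tphi k).
    by under eq_fun do rewrite mxE.
  + by move=> x _; rewrite lee_fin sqr_ge0.
  + exact: measurable_half_space.
  apply: eq_integral => x _; rewrite -EFinM -enormZ_sqr// scalerBr gradZ//.
  exact: (tphi k).1.
- rewrite -[X in _ --> X](mule0 (c `^ crit N 0)%:E).
  have := cvgeZl (isT : (c `^ crit N 0)%:E \is a fin_num) cu.
  apply: cvg_trans; apply: near_eq_cvg; apply: nearW => k.
  rewrite -ge0_integralZl_EFin ?powR_ge0//; first last.
  + apply/measurable_EFinP; apply: measurable_powR_fun.
    apply: measurableT_comp => //; apply: measurable_funB => //.
    exact: test_function_measurable.
  + exact: measurable_half_space.
  apply: eq_integral => x _; rewrite -EFinM -powRM ?(ltW c0)//.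
  by rewrite -mulrBr normrM gtr0_norm.
Qed.

Lemma weak_poissonZ (c : R) G f : 0 < c ->
  (forall i, measurable_fun half_space (fun x => G x ord0 i)) ->
  weak_poisson G f ->
  weak_poisson (fun x => c *: G x) (fun x => c * f x).
Proof.
move=> c0 mG Gf phi tphi; have [intf eqf] := Gf phi tphi; split.
  have := integrableZl (@measurable_half_space R N) c intf.
  apply: eq_integrable; first exact: measurable_half_space.
  by move=> x _ /=; rewrite -EFinM mulrA.
under eq_Rintegral do rewrite dotZl.
rewrite integralZl_gt0//; first last.
- by apply: measurable_dot => // i; exact: grad_measurable.
- exact: measurable_half_space.
under [RHS]eq_Rintegral do rewrite -mulrA.
by rewrite RintegralZl//; [rewrite eqf|exact: measurable_half_space].
Qed.

(** Measurability of the new right-hand side must be assumed because the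
Lebesgue measure on Borel sets is not complete. *)
Lemma ae_eq_weak_poisson G f g : measurable_fun half_space g ->
  {ae lebesgue_rV R N, forall x, half_space x -> f x = g x} ->
  weak_poisson G f -> weak_poisson G g.
Proof.
move=> mg fg Gf phi tphi; have [intf eqf] := Gf phi tphi.
have mH := @measurable_half_space R N.
have mgp : measurable_fun half_space (EFin \o (fun x => g x * phi x)).
  apply/measurable_EFinP/measurable_funM => //.
  exact: test_function_measurable.
have mfp := measurable_int _ intf.
have fgp : ae_eq (lebesgue_rV R N) half_space
    (EFin \o (fun x => f x * phi x)) (EFin \o (fun x => g x * phi x)).
  by apply: filterS fg => x fgx Hx /=; rewrite fgx.
split; last by rewrite eqf; congr fine; exact: ae_eq_integral.
apply/integrableP; split => //.
move/integrableP: intf => [_]; congr (_ < _)%E.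
apply: ae_eq_integral => //; do ?exact: measurableT_comp.
by apply: filterS fgp => x fgx Hx; rewrite fgx.
Qed.

End weak_solutions.

(** * The decoupled system *)

Lemma gt0_powRD (R : realType) (y p q : R) : 0 < y ->
  y `^ (p + q) = y `^ p * y `^ q.
Proof. by move=> y0; rewrite powRD// (lt0r_neq0 y0) implybT. Qed.

Lemma gt0_powRB1 (R : realType) (y p : R) : 0 < y ->
  y `^ (p - 1) = y `^ (p - 2) * y.
Proof.
move=> y0; rewrite -[X in _ * X]powRr1 ?ltW// -gt0_powRD//.
by congr (_ `^ _); ring.
Qed.

Theorem corollary3 (R : realType) (N : nat)
    (s1 s2 mu kappa alpha beta lambda : R) (w : 'rV[R]_N -> R)
    (hN : (3 <= N)%N)
    (hs1 : 0 < s1 < 2) (hs2 : 0 < s2 < 2)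
    (hmu : 0 < mu) (hkappa : kappa != 0)
    (halpha : 1 < alpha) (hbeta : 1 < beta)
    (hab : alpha + beta = crit N s2)
    (hlambda : lambda = mu * (beta / alpha) `^ ((crit N s1 - 2) / 2))
    (hcases :
      [/\ 0 < s1, s1 < s2, s2 < 2 & kappa != 0] \/
      (s2 < s1 /\ 0 < kappa) \/
      (s1 = s2 /\
        - lambda * (1 / alpha) * (alpha / beta) `^ (beta / 2) < kappa))
    (hw : least_energy_solution s1 s2
            lambda (kappa * alpha * (beta / alpha) `^ (beta / 2)) w) :
  positive_system_solution s1 s2 lambda mu kappa alpha beta
    w (fun x => Num.sqrt (beta / alpha) * w x).
Proof.
have [G [[wG w0 Gw] _]] := hw.
have a0 : 0 < alpha by exact: lt_trans halpha.
have b0 : 0 < beta by exact: lt_trans hbeta.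
set t := Num.sqrt (beta / alpha).
have t0 : 0 < t by rewrite sqrtr_gt0 divr_gt0.
have t_sqr : beta = alpha * t ^+ 2.
  by rewrite sqr_sqrtr ?divr_ge0 ?ltW// mulrCA divff ?gt_eqF// mulr1.
have t_pow p : (beta / alpha) `^ (p / 2) = t `^ p.
  by rewrite powRrM powRAC powR12_sqrt// divr_ge0 ?ltW.
rewrite !t_pow in hlambda hw Gw *.
have [mw mG _] := wG.
have mwn q : measurable_fun (@half_space R N) (fun x => `|w x| `^ q).
  by apply: measurable_powR_fun; exact: measurableT_comp.
have mtwn q : measurable_fun (@half_space R N) (fun x => `|t * w x| `^ q).
  apply: measurable_powR_fun; apply: measurableT_comp => //.
  exact: measurable_funM.
split => //; last first.
  by apply: filterS w0 => x w0 /w0; exact: mulr_gt0.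
exists G, (fun x => t *: G x); split => //.
- exact: D012_gradZ.
(* First equation: the two right-hand sides agree where [w > 0]. *)
- apply: ae_eq_weak_poisson Gw.
    apply: measurable_funD; apply: measurable_funM => //;
      apply: measurable_singular_weight; do ?exact: measurable_funM.
    by apply: measurable_funM => //; exact: measurable_funM.
  apply: filterS w0 => x w0 /w0 {}w0.
  rewrite !gtr0_norm ?mulr_gt0//.
  have -> : w x `^ (crit N s2 - 1) = w x `^ (alpha - 2) * w x * w x `^ beta.
    by rewrite -hab addrAC (gt0_powRD _ _ (alpha - 1))// gt0_powRB1.
  rewrite gt0_powRB1// powRM ?ltW//; ring.
(* Second equation: its right-hand side is [t] times the scalar one. *)
- apply: ae_eq_weak_poisson (weak_poissonZ _ _ _ _ _ t0 mG Gw).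
    apply: measurable_funD; apply: measurable_funM => //;
      apply: measurable_singular_weight.
      by apply: measurable_funM => //; exact: measurable_funM.
    by apply: measurable_funM; exact: measurable_funM.
  apply: filterS w0 => x w0 /w0 {}w0.
  rewrite !gtr0_norm ?mulr_gt0//.
  have -> : w x `^ (crit N s2 - 1) = w x `^ alpha * (w x `^ (beta - 2) * w x).
    by rewrite -hab -addrA (gt0_powRD _ _ alpha)// gt0_powRB1.
  have -> : t `^ beta = t `^ (beta - 2) * t ^+ 2.
    by rewrite -powR_mulrn ?ltW// -gt0_powRD// subrK.
  rewrite hlambda gt0_powRB1// !powRM ?ltW//.
  by rewrite [X in kappa * X * (_ / _)]t_sqr; ring.
Qed.
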